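(* Let $\Omega\subset\mathbb{R}^d$ be compact with a probability measure $\mu$, let $2\le p<\infty$, and let $\mathcal{D}_N=\{\varphi_j\}_{j=1}^N\subset\mathcal{C}(\Omega)$ be a uniformly bounded Riesz system, i.e. $\sup_{x\in\Omega}|\varphi_j(x)|\le 1$ for all $j$ and, for some constants $0<R_1\le R_2<\infty$ and all $(a_1,\dots,a_N)\in\mathbb{C}^N$, $$R_1\Big(\sum_{j=1}^N|a_j|^2\Big)^{1/2}\le\Big\|\sum_{j=1}^N a_j\varphi_j\Big\|_{L_2(\Omega,\mu)}\le R_2\Big(\sum_{j=1}^N|a_j|^2\Big)^{1/2}.$$ Let $1\le u\le N$ be an integer, and let $\Omega_m=\{\xi^1,\dots,\xi^m\}\subset\Omega$ provide $L_2$-universal sampling discretization for the collection $\mathcal{X}_u(\mathcal{D}_N)$. Assume in addition that $\mathcal{D}_N\in NI(2,p,H,u)$. Then for every weakness parameter $t\in(0,1]$ there exists an integer $c=c(t,R_1,R_2)\ge 1$ such that for every integer $0\le v\le u/(1+c)$ and every $f_0\in\mathcal{C}(\Omega)$, the algorithm $\mathrm{WOMP}(\mathcal{D}_N(\Omega_m);t)_{L_2(\Omega_m,\mu_m)}$ applied to $f_0$ satisfies $$\|f_{cv}\|_{L_2(\Omega_m,\mu_m)}\le C_0\,\sigma_v(f_0,\mathcal{D}_N(\Omega_m))_{L_2(\Omega_m,\mu_m)},$$ $$\|f_{cv}\|_{L_p(\Omega,\mu)}\le H C_1\,\sigma_v(f_0,\mathcal{D}_N)_{L_p(\Omega,\mu_\xi)},$$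 where $C_0,C_1$ are absolute constants and $f_k$ is the residual after the $k$-th iteration.
   Context: For a system $\mathcal{D}=\{g_i\}$ in a normed space $X$ and a finite index set $J$, $V_J(\mathcal{D})=\operatorname{span}\{g_j:j\in J\}$; $\mathcal{X}_v(\mathcal{D})$ is the collection of all $V_J(\mathcal{D})$ with $|J|=v$; $\Sigma_v(\mathcal{D})=\bigcup_{V\in\mathcal{X}_v(\mathcal{D})}V$ (all $v$-term linear combinations); $\sigma_v(f,\mathcal{D})_X=\inf_{g\in\Sigma_v(\mathcal{D})}\|f-g\|_X$. For a measure $\nu$ on $\Omega$, $\|f\|_{L_p(\nu)}=(\int_\Omega|f|^p d\nu)^{1/p}$. A set $\xi=\{\xi^j\}_{j=1}^m\subset\Omega$ provides $L_p$-universal sampling discretization for a collection $\mathcal{X}$ of finite-dimensional subspaces if $\frac12\|f\|_p^p\le\frac1m\sum_{j=1}^m|f(\xi^j)|^p\le\frac32\|f\|_p^p$ for all $f\in\bigcup_{X\in\mathcal{X}}X$. $\mu_m=\frac1m\sum_{j=1}^m\delta_{\xi^j}$ is the uniform probability measure on $\Omega_m$, $L_2(\Omega_m,\mu_m)$ the corresponding Hilbert space, and $\mu_\xi=(\mu+\mu_m)/2$. $\mathcal{D}_N(\Omega_m)$ is the system of restrictions of the $\varphi_j$ to $\Omega_m$. $u$-term Nikol'skii inequality: for $1\le q\le p\le\infty$, a system $\Psi$ satisfies $\Psi\in NI(q,p,H,u)$ if $\|f\|_{L_p(\Omega,\mu)}\le H\|f\|_{L_q(\Omega,\mu)}$ for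 all $f\in\Sigma_u(\Psi)$ (necessarily $H\ge1$). WOMP: given a Hilbert space $H$ with inner product $\langle\cdot,\cdot\rangle$, a system $\mathcal{D}$ of nonzero elements of norm $\le1$, $t\in(0,1]$ and $f_0\in H$: for $k=1,2,\dots$ choose $g_k\in\mathcal{D}$ with $|\langle f_{k-1},g_k\rangle|\ge t\sup_{g\in\mathcal{D}}|\langle f_{k-1},g\rangle|$; let $G_k(f_0)$ be the orthogonal projection of $f_0$ onto $\operatorname{span}\{g_1,\dots,g_k\}$, and $f_k=f_0-G_k(f_0)$. Here it is run in $L_2(\Omega_m,\mu_m)$ on $f_0|_{\Omega_m}$ with dictionary $\mathcal{D}_N(\Omega_m)$; the projection $G_k(f_0)=\sum c_i\varphi_{i}|_{\Omega_m}$ (a combination of the selected elements) is identified with the function $\sum c_i\varphi_i$ on $\Omega$, and $f_k=f_0-G_k(f_0)$ is regarded as a function on $\Omega$ when its $L_p(\Omega,\mu)$ norm is taken. *)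

(* Defs.v *)
From HB Require Import structures.
From mathcomp Require Import all_boot all_order all_algebra.
From mathcomp Require Import all_classical all_reals all_analysis.
From mathcomp Require Import complex.
Import Order.TTheory GRing.Theory Num.Theory.
Import numFieldNormedType.Exports.
Local Open Scope classical_set_scope.
Local Open Scope ring_scope.
Set Implicit Arguments. Unset Strict Implicit. Unset Printing Implicit Defensive.

Definition Rd (R : realType) (d : nat) :=
  g_sigma_algebraType (open : set (set 'rV[R]_d)).

Definition cabs (R : realType) (z : R[i]) : R :=
  Num.sqrt ((complex.Re z) ^+ 2 + (complex.Im z) ^+ 2).

Definition ccont_on (R : realType) (d : nat) (Om : set 'rV[R]_d)
  (f : 'rV[R]_d -> R[i]) : Prop :=
  {within Om, continuous (fun x => complex.Re (f x))} /\
  {within Om, continuous (fun x => complex.Im (f x))}.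

Lemma inv_natr_ge0 (R : realType) (n : nat) : 0 <= (n%:R : R)^-1.
Proof. by rewrite invr_ge0. Qed.

Definition mu_m (R : realType) (d m : nat) (xi : 'I_m -> 'rV[R]_d) :=
  mscale (NngNum (inv_natr_ge0 R m))
    (msum (fun j : nat => match @insub nat (fun k => (k < m)%N) 'I_m j with
                          | Some k => @dirac _ (Rd R d) (xi k) R
                          | None => @mzero _ (Rd R d) R end) m).

Definition mu_xi (R : realType) (d m : nat) (mu : probability (Rd R d) R)
  (xi : 'I_m -> 'rV[R]_d) :=
  mscale (NngNum (inv_natr_ge0 R 2)) (measure_add mu (mu_m xi)).

Definition normLp (R : realType) (d : nat) (nu : {measure set (Rd R d) -> \bar R})
  (Om : set 'rV[R]_d) (p : R) (f : 'rV[R]_d -> R[i]) : R :=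
  (fine (\int[nu]_(x in Om) ((cabs (f x)) `^ p)%:E)) `^ p^-1.

Definition lincomb (R : realType) (d N : nat) (phi : 'I_N -> 'rV[R]_d -> R[i])
  (a : 'I_N -> R[i]) : 'rV[R]_d -> R[i] :=
  fun x => \sum_(j < N) a j * phi j x.

Definition supported_on (R : realType) (N : nat) (a : 'I_N -> R[i])
  (J : {set 'I_N}) : Prop :=
  forall j, j \notin J -> a j = 0.

(** coefficient vectors of elements of Sigma_v (J with |J| = v) *)
Definition vterm (R : realType) (N v : nat) : set ('I_N -> R[i]) :=
  [set a | exists J : {set 'I_N}, #|J| = v /\ supported_on a J].

Definition ipm (R : realType) (d m : nat) (xi : 'I_m -> 'rV[R]_d)
  (f g : 'rV[R]_d -> R[i]) : R[i] :=
  ((m%:R)^-1 : R[i]) * \sum_(j < m) f (xi j) * conjc (g (xi j)).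

Definition normm (R : realType) (d m : nat) (xi : 'I_m -> 'rV[R]_d)
  (f : 'rV[R]_d -> R[i]) : R :=
  Num.sqrt ((m%:R)^-1 * \sum_(j < m) (cabs (f (xi j))) ^+ 2).

Definition resid (R : realType) (d N : nat) (phi : 'I_N -> 'rV[R]_d -> R[i])
  (f0 : 'rV[R]_d -> R[i]) (c : 'I_N -> R[i]) : 'rV[R]_d -> R[i] :=
  fun x => f0 x - lincomb phi c x.

Definition sigma_m (R : realType) (d N m : nat) (xi : 'I_m -> 'rV[R]_d)
  (v : nat) (phi : 'I_N -> 'rV[R]_d -> R[i]) (f0 : 'rV[R]_d -> R[i]) : R :=
  inf [set normm xi (resid phi f0 a) | a in @vterm R N v].

Definition sigma_xi (R : realType) (d N m : nat) (mu : probability (Rd R d) R)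
  (xi : 'I_m -> 'rV[R]_d) (Om : set 'rV[R]_d) (p : R) (v : nat)
  (phi : 'I_N -> 'rV[R]_d -> R[i]) (f0 : 'rV[R]_d -> R[i]) : R :=
  inf [set normLp (mu_xi mu xi) Om p (resid phi f0 a) | a in @vterm R N v].

(** set of indices selected during the first k steps of the greedy algorithm:
    sel i is the index of g_{i+1} *)
Definition selected (N : nat) (sel : nat -> 'I_N) (k : nat) : {set 'I_N} :=
  [set sel (nat_of_ord i) | i : 'I_k].

Definition is_proj_coef (R : realType) (d N m : nat) (xi : 'I_m -> 'rV[R]_d)
  (phi : 'I_N -> 'rV[R]_d -> R[i]) (S : {set 'I_N}) (f0 : 'rV[R]_d -> R[i])
  (c : 'I_N -> R[i]) : Prop :=
  supported_on c S /\ forall j, j \in S -> ipm xi (resid phi f0 c) (phi j) = 0.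

(** sel is a run of WOMP(D_N(Omega_m); t)_{L_2(Omega_m, mu_m)} on f0:
    at step k+1, g_{k+1} = phi_(sel k) satisfies
    |<f_k, g_{k+1}>| >= t sup_j |<f_k, phi_j>|, where f_k = f0 - G_k(f0). *)
Definition womp_run (R : realType) (d N m : nat) (t : R) (xi : 'I_m -> 'rV[R]_d)
  (phi : 'I_N -> 'rV[R]_d -> R[i]) (f0 : 'rV[R]_d -> R[i]) (sel : nat -> 'I_N) : Prop :=
  forall (k : nat) (c : 'I_N -> R[i]), is_proj_coef xi phi (selected sel k) f0 c ->
    t * \big[Num.max/0]_(j < N) cabs (ipm xi (resid phi f0 c) (phi j))
      <= cabs (ipm xi (resid phi f0 c) (phi (sel k))).

Definition riesz (R : realType) (d N : nat) (mu : probability (Rd R d) R)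
  (Om : set 'rV[R]_d) (phi : 'I_N -> 'rV[R]_d -> R[i]) (R1 R2 : R) : Prop :=
  forall a : 'I_N -> R[i],
    R1 * Num.sqrt (\sum_(j < N) (cabs (a j)) ^+ 2) <= normLp mu Om 2 (lincomb phi a) /\
    normLp mu Om 2 (lincomb phi a) <= R2 * Num.sqrt (\sum_(j < N) (cabs (a j)) ^+ 2).

Definition L2_usd (R : realType) (d N m : nat) (mu : probability (Rd R d) R)
  (Om : set 'rV[R]_d) (phi : 'I_N -> 'rV[R]_d -> R[i]) (u : nat)
  (xi : 'I_m -> 'rV[R]_d) : Prop :=
  forall a, @vterm R N u a ->
    2^-1 * (normLp mu Om 2 (lincomb phi a)) ^+ 2
      <= (m%:R)^-1 * \sum_(j < m) (cabs (lincomb phi a (xi j))) ^+ 2 /\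
    (m%:R)^-1 * \sum_(j < m) (cabs (lincomb phi a (xi j))) ^+ 2
      <= 3 / 2 * (normLp mu Om 2 (lincomb phi a)) ^+ 2.

Definition NI (R : realType) (d N : nat) (mu : probability (Rd R d) R)
  (Om : set 'rV[R]_d) (phi : 'I_N -> 'rV[R]_d -> R[i]) (q p H : R) (u : nat) : Prop :=
  forall a, @vterm R N u a ->
    normLp mu Om p (lincomb phi a) <= H * normLp mu Om q (lincomb phi a).

(* Main.v *)
Require Import Defs.
From HB Require Import structures.
From mathcomp Require Import all_boot all_order all_algebra.
From mathcomp Require Import all_classical all_reals all_analysis.
From mathcomp Require Import complex.
From mathcomp Require Import zify ring lra.
Import Order.TTheory GRing.Theory Num.Theory.
Import numFieldNormedType.Exports.
Local Open Scope classical_set_scope.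
Local Open Scope ring_scope.

Set Implicit Arguments. Unset Strict Implicit. Unset Printing Implicit Defensive.

(** In the discrete norm each greedy step removes at least [t^2 max_j |<f_k, phi_j>|^2] from the
    energy [|f_k|^2], and the Riesz bounds on u-sparse combinations bound that maximum from below:
    if a target [w] needs at most [s] indices not yet selected, the energy excess of [f_k] over
    [|f_0 - w|^2] shrinks at a rate of order [t^2 R1^2 / s].  Zhang's argument for orthogonal
    matching pursuit avoids a logarithmic loss: were the energy still above [8 |f_0 - g|^2] after
    [c v] steps, for a v-term [g], targets keeping [s] missing indices of [g] would force it to
    drop so fast on dyadic scales of [s] that the initial energy would vanish.

    For the L_p bound, write [f_{cv} = (f_0 - g) + (g - G_{cv})]; the second summand is u-sparse, so
    its L_p norm is at most [H] times its L_2 norm, which universal discretization compares with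
    its discrete norm.  Only [mu <= 2 mu_xi], [mu_m <= 2 mu_xi] and elementary substitutes (up to
    constants) for Jensen's and Minkowski's inequalities are needed. *)

(** * The modulus of a complex number and its square *)

Section ComplexModulus.
Variable R : realType.
Implicit Types z w : R[i].

Lemma cabsE z : cabs z = Normc.normc z.
Proof. by case: z. Qed.

Lemma cabs_ge0 z : 0 <= cabs z.
Proof. exact: sqrtr_ge0. Qed.

Lemma cabs0 : cabs (0 : R[i]) = 0.
Proof. by rewrite cabsE Normc.normc0. Qed.

Lemma cabs1 : cabs (1 : R[i]) = 1.
Proof. by rewrite cabsE Normc.normc1. Qed.

Lemma cabsN z : cabs (- z) = cabs z.
Proof. by rewrite !cabsE normcN. Qed.

Lemma cabsM z w : cabs (z * w) = cabs z * cabs w.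
Proof. by rewrite !cabsE Normc.normcM. Qed.

Lemma cabs_conj z : cabs (conjc z) = cabs z.
Proof. by case: z => a b; rewrite /cabs /= sqrrN. Qed.

Lemma cabsD_le z w : cabs (z + w) <= cabs z + cabs w.
Proof. by rewrite !cabsE le_normcD. Qed.

Lemma cabs_sqr z : cabs z ^+ 2 = complex.Re z ^+ 2 + complex.Im z ^+ 2.
Proof. by rewrite sqr_sqrtr // addr_ge0 // sqr_ge0. Qed.

Lemma Re_le_cabs z : complex.Re z <= cabs z.
Proof.
rewrite (le_trans (ler_norm _)) // -sqrtr_sqr ler_wsqrtr //.
by rewrite lerDl sqr_ge0.
Qed.

Lemma cabs_sqrD_le z w : cabs (z + w) ^+ 2 <= 2 * cabs z ^+ 2 + 2 * cabs w ^+ 2.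
Proof.
case: z w => a b [c d]; rewrite !cabs_sqr /=; have := sqr_ge0 (a - c).
by have := sqr_ge0 (b - d); nra.
Qed.

Lemma Re_sum (I : Type) (r : seq I) (P : pred I) (F : I -> R[i]) :
  complex.Re (\sum_(i <- r | P i) F i) = \sum_(i <- r | P i) complex.Re (F i).
Proof. by apply: (big_morph _ _ _) => // -[a b] [c e]. Qed.

End ComplexModulus.

(** * The inner product and squared norm over the sample points *)

Section DiscreteInnerProduct.
Variables (R : realType) (d m : nat) (xi : 'I_m -> 'rV[R]_d).
Implicit Types f g : 'rV[R]_d -> R[i].

Definition normm_sqr f : R := (m%:R)^-1 * \sum_(j < m) cabs (f (xi j)) ^+ 2.

Lemma normm_sqr_ge0 f : 0 <= normm_sqr f.
Proof.
by apply: mulr_ge0; rewrite ?inv_natr_ge0 // sumr_ge0 // => j _; rewrite sqr_ge0.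
Qed.

Lemma normmE f : normm xi f = Num.sqrt (normm_sqr f).
Proof. by []. Qed.

Lemma eq_normm_sqr f g : (forall x, f x = g x) -> normm_sqr f = normm_sqr g.
Proof. by move=> fg; congr (_ * _); apply: eq_bigr => j _; rewrite fg. Qed.

Lemma normm_sqrD_le f g :
  normm_sqr (fun x => f x + g x) <= 2 * normm_sqr f + 2 * normm_sqr g.
Proof.
rewrite /normm_sqr !(mulrCA 2) -mulrDr ler_wpM2l ?inv_natr_ge0 //.
rewrite !mulr_sumr -big_split ler_sum // => j _; exact: cabs_sqrD_le.
Qed.

Lemma normm_sqr_le1 f : (forall j, cabs (f (xi j)) <= 1) -> normm_sqr f <= 1.
Proof.
(* For [m = 0] the prefactor [m%:R^-1] is 0, so the mean vanishes. *)
move=> f1; rewrite /normm_sqr; have [->|m0] := eqVneq m%:R (0 : R).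
  by rewrite invr0 mul0r ler01.
have : \sum_(j < m) cabs (f (xi j)) ^+ 2 <= \sum_(j < m) 1.
  by apply: ler_sum => j _; rewrite expr_le1 ?cabs_ge0.
by rewrite sumr_const card_ord ler_pdivrMl ?mulr1 // lt0r m0 ler0n.
Qed.

Lemma invn_complex : ((m%:R)^-1 : R[i]) = ((m%:R)^-1 : R)%:C%C.
Proof. by rewrite fmorphV /= rmorph_nat. Qed.

Lemma Re_mul_ipm z f g : complex.Re (z * ipm xi f g) =
  (m%:R)^-1 * \sum_(j < m) complex.Re (z * (f (xi j) * conjc (g (xi j)))).
Proof.
rewrite /ipm invn_complex mulrCA mulr_sumr -Re_sum.
by case: (\sum_(j < m) _) => a b /=; rewrite mul0r subr0.
Qed.

(** Used with [z = 1] for the optimality of projections and for comparing targets, and with [z] the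
    inner product of [f] and [g] for the gain of one greedy step. *)
Lemma normm_sqr_subZ z f g : normm_sqr (fun x => f x - z * g x) =
  normm_sqr f - 2 * complex.Re (conjc z * ipm xi f g) + cabs z ^+ 2 * normm_sqr g.
Proof.
rewrite Re_mul_ipm /normm_sqr mulrCA (mulrCA (cabs z ^+ 2)) -mulrBr -mulrDr.
congr (_ * _); rewrite !mulr_sumr -sumrB -big_split /=.
apply: eq_bigr => j _; rewrite !cabs_sqr.
case: z (f _) (g _) => [a b] [a1 b1] [a2 b2] /=; ring.
Qed.

Lemma ipmBl f g h : ipm xi (fun x => f x - g x) h = ipm xi f h - ipm xi g h.
Proof.
rewrite /ipm -mulrBr -sumrB; congr (_ * _); apply: eq_bigr => j _.
by rewrite mulrBl.
Qed.

Lemma ipmZl z f h : ipm xi (fun x => z * f x) h = z * ipm xi f h.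
Proof.
rewrite /ipm [RHS]mulrCA; congr (_ * _); rewrite mulr_sumr; apply: eq_bigr => j _.
by rewrite mulrA.
Qed.

Lemma ipmBr f g h : ipm xi h (fun x => f x - g x) = ipm xi h f - ipm xi h g.
Proof.
rewrite /ipm -mulrBr -sumrB; congr (_ * _); apply: eq_bigr => j _.
by rewrite rmorphB mulrBr.
Qed.

Lemma eq_ipml f f' g : (forall x, f x = f' x) -> ipm xi f g = ipm xi f' g.
Proof. by move=> ff; congr (_ * _); apply: eq_bigr => j _; rewrite ff. Qed.

Lemma ipm_self f : ipm xi f f = (normm_sqr f)%:C%C.
Proof.
rewrite /ipm /normm_sqr rmorphM /= -invn_complex rmorph_sum /=; congr (_ * _).
apply: eq_bigr => j _; rewrite cabs_sqr.
by case: (f _) => a b; apply/eqP; rewrite eq_complex /=; apply/andP; split; apply/eqP; ring.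
Qed.

(** [normm_sqr] is only a seminorm, but a null function vanishes at every sample point, unless
    [m = 0], when the pairing is 0 anyway. *)
Lemma ipm_eq0_of_normm_sqr f g : normm_sqr g = 0 -> ipm xi f g = 0.
Proof.
move=> g0; have /eqP := g0; rewrite mulf_eq0 invr_eq0 => /orP[/eqP m0|].
  by rewrite /ipm invn_complex m0 invr0 mul0r.
rewrite psumr_eq0 => [/allP g0'|j _]; last exact: sqr_ge0.
rewrite /ipm big1 ?mulr0 // => j _.
have := g0' j (mem_index_enum _); rewrite sqrf_eq0 cabsE => /eqP/Normc.eq0_normc ->.
by rewrite conjc0 mulr0.
Qed.

(** * Linear combinations of the system and discrete orthogonal projections *)

Section Dictionary.
Variables (N : nat) (phi : 'I_N -> 'rV[R]_d -> R[i]).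
Implicit Types a b c : 'I_N -> R[i].

Lemma lincombB a b x :
  lincomb phi (fun j => a j - b j) x = lincomb phi a x - lincomb phi b x.
Proof. by rewrite /lincomb -sumrB; apply: eq_bigr => j _; rewrite mulrBl. Qed.

Lemma lincombZ z a x : lincomb phi (fun j => z * a j) x = z * lincomb phi a x.
Proof. by rewrite /lincomb mulr_sumr; apply: eq_bigr => j _; rewrite mulrA. Qed.

Lemma lincomb_delta i x : lincomb phi (fun j => (j == i)%:R) x = phi i x.
Proof.
rewrite /lincomb (bigD1 i) //= eqxx mul1r big1 ?addr0 // => j /negbTE ->.
by rewrite mul0r.
Qed.

Lemma ipm_lincomb f a :
  ipm xi f (lincomb phi a) = \sum_(j < N) conjc (a j) * ipm xi f (phi j).
Proof.
rewrite /ipm /lincomb; under eq_bigr do rewrite rmorph_sum mulr_sumr.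
rewrite exchange_big mulr_sumr; apply: eq_bigr => j _.
rewrite [RHS]mulrCA; congr (_ * _); rewrite mulr_sumr; apply: eq_bigr => i _.
by rewrite rmorphM mulrCA.
Qed.

Lemma supported_onB a b (S : {set 'I_N}) : supported_on a S -> supported_on b S ->
  supported_on (fun j => a j - b j) S.
Proof. by move=> aS bS j jS; rewrite aS ?bS ?subr0. Qed.

Lemma supported_on_sub a (S T : {set 'I_N}) : S \subset T -> supported_on a S ->
  supported_on a T.
Proof. by move=> ST aS j jT; apply/aS/(contra _ jT)/(fintype.subsetP ST). Qed.

(** Gram-Schmidt by induction on [#|S|]: with [q] the part of [phi i] orthogonal to the other
    elements, the projection of [f] on them is corrected by a multiple of [q], or left as it is when
    [q] is null. *)
Lemma is_proj_coef_exists (S : {set 'I_N}) f :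
  exists c, is_proj_coef xi phi S f c.
Proof.
have [n] := ubnP #|S|; elim: n S f => // n IHn S f.
have [->|[i iS]] := set_0Vmem S.
  by exists (fun=> 0); split => // j; rewrite inE.
rewrite ltnS (cardsD1 i) iS add1n => cS.
have [c [cS' cO]] := IHn _ f cS; have [e [eS eO]] := IHn _ (phi i) cS.
have SS : S :\ i \subset S by rewrite subD1set.
set r := resid phi f c in cO; set q := resid phi (phi i) e in eO.
have rq : ipm xi r q = ipm xi r (phi i).
  rewrite ipmBr ipm_lincomb big1 ?subr0 // => j _.
  have [jS|/eS ->] := boolP (j \in S :\ i); last by rewrite conjc0 mul0r.
  by rewrite cO ?mulr0.
have qq : ipm xi q q = ipm xi q (phi i).
  rewrite {2}/q ipmBr ipm_lincomb big1 ?subr0 // => j _.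
  have [jS|/eS ->] := boolP (j \in S :\ i); last by rewrite conjc0 mul0r.
  by rewrite eO ?mulr0.
have [q0|q0] := eqVneq (normm_sqr q) 0.
  exists c; split=> [|j jS]; first exact: supported_on_sub cS'.
  have [->|ji] := eqVneq j i; first by rewrite -rq ipm_eq0_of_normm_sqr.
  by rewrite cO // !inE ji.
pose z := ipm xi r q / ipm xi q q.
(* The coefficients are those of [c] plus [z] times those of [q]; the double sign lets [lincombB]
   apply, and the residual becomes [r - z * q]. *)
exists (fun j => c j - (- z) * ((j == i)%:R - e j)); split.
  apply: supported_onB; first exact: supported_on_sub cS'.
  move=> j jS; rewrite (_ : e j = 0); last by apply: eS; rewrite !inE (negbTE jS) andbF.
  have /negbTE -> : j != i by apply: contraNneq jS => ->.
  by rewrite subrr mulr0.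
have E x : resid phi f (fun j => c j - (- z) * ((j == i)%:R - e j)) x = r x - z * q x.
  rewrite /r /q /resid lincombB lincombZ lincombB lincomb_delta; ring.
move=> j jS; rewrite (eq_ipml _ E) ipmBl ipmZl.
have [->|ji] := eqVneq j i; last by rewrite cO ?eO ?mulr0 ?subrr // !inE ji.
by rewrite -rq -qq divfK ?subrr // ipm_self; apply: contraNneq q0 => -[->].
Qed.

Lemma proj_resid_orth (S : {set 'I_N}) f c a : is_proj_coef xi phi S f c ->
  ipm xi (resid phi f c) (lincomb phi a) =
  \sum_(j in ~: S) conjc (a j) * ipm xi (resid phi f c) (phi j).
Proof.
move=> [_ cO]; rewrite ipm_lincomb (bigID (mem (~: S))) /= [X in _ + X]big1 ?addr0 //.
by move=> j; rewrite inE negbK => /cO ->; rewrite mulr0.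
Qed.

(** Pythagoras: the two residuals differ by a combination supported on [S], to which the projection
    residual is orthogonal. *)
Lemma proj_resid_min (S : {set 'I_N}) f c w : is_proj_coef xi phi S f c ->
  supported_on w S -> normm_sqr (resid phi f c) <= normm_sqr (resid phi f w).
Proof.
move=> cP wS; have [cS _] := cP; have wc := supported_onB wS cS.
rewrite (@eq_normm_sqr (resid phi f w)
  (fun x => resid phi f c x - 1 * lincomb phi (fun j => w j - c j) x)); last first.
  by move=> x; rewrite /resid lincombB; ring.
rewrite normm_sqr_subZ (proj_resid_orth _ cP) big1 => [|j]; last first.
  by rewrite inE => jS; rewrite wc // conjc0 mul0r.
by rewrite mulr0 mulr0 subr0 cabs1 expr1n mul1r lerDl normm_sqr_ge0.
Qed.

End Dictionary.
End DiscreteInnerProduct.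

(** * Energy decay of the greedy residuals, given frame bounds [alpha], [beta] on u-sparse
    combinations *)

Section GreedyResiduals.
Variables (R : realType) (d m N : nat) (xi : 'I_m -> 'rV[R]_d).
Variables (phi : 'I_N -> 'rV[R]_d -> R[i]) (t alpha beta : R) (u : nat).
Hypotheses (t_ge0 : 0 <= t) (alpha_gt0 : 0 < alpha) (beta_ge0 : 0 <= beta).
Hypothesis phi_le1 : forall j, normm_sqr xi (phi j) <= 1.

Definition coef_sqr (a : 'I_N -> R[i]) (S : {set 'I_N}) : R :=
  \sum_(j in S) cabs (a j) ^+ 2.

Hypothesis sparse_lower : forall (a : 'I_N -> R[i]) (S : {set 'I_N}),
  (#|S| <= u)%N -> supported_on a S ->
  alpha * coef_sqr a [set: 'I_N] <= normm_sqr xi (lincomb phi a).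
Hypothesis sparse_upper : forall (a : 'I_N -> R[i]) (S : {set 'I_N}),
  (#|S| <= u)%N -> supported_on a S ->
  normm_sqr xi (lincomb phi a) <= beta * coef_sqr a [set: 'I_N].

Lemma coef_sqr_subset a (S T : {set 'I_N}) : S \subset T -> coef_sqr a S <= coef_sqr a T.
Proof.
move=> ST; rewrite /coef_sqr [leRHS](big_setID S) /= (finset.setIidPr ST) lerDl.
by apply: sumr_ge0 => j _; rewrite sqr_ge0.
Qed.

Variables (f0 : 'rV[R]_d -> R[i]) (sel : nat -> 'I_N) (G : nat -> 'I_N -> R[i]).
Hypothesis sel_run : womp_run t xi phi f0 sel.
Hypothesis G_proj : forall k, is_proj_coef xi phi (selected sel k) f0 (G k).

Local Notation S := (selected sel).

Definition energy k : R := normm_sqr xi (resid phi f0 (G k)).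

Lemma energy_ge0 k : 0 <= energy k.
Proof. exact: normm_sqr_ge0. Qed.

Lemma selectedS k : S k.+1 = sel k |: S k.
Proof.
apply/finset.setP => j; rewrite !inE; apply/imsetP/orP => [[i _ ->]|[/eqP ->|/imsetP[i _ ->]]].
- have [ik|ik] := ltnP i k; last first.
    by left; apply/eqP; congr sel; apply/eqP; rewrite eqn_leq ik -ltnS ltn_ord.
  by right; apply/imsetP; exists (Ordinal ik).
- by exists ord_max.
- by exists (widen_ord (leqnSn k) i).
Qed.

Lemma selected_mono k l : (k <= l)%N -> S k \subset S l.
Proof.
move=> /subnK <-; elim: (l - k)%N => [|n IHn]; first by rewrite add0n.
by rewrite addSn selectedS (fintype.subset_trans IHn) // finset.subsetUr.
Qed.

Lemma card_selected k : (#|S k| <= k)%N.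
Proof. by rewrite (leq_trans (leq_imset_card _ _)) // card_ord. Qed.

Definition max_corr k : R := \big[Num.max/0]_(j < N) cabs (ipm xi (resid phi f0 (G k)) (phi j)).

Lemma max_corr_ge0 k : 0 <= max_corr k.
Proof. exact: bigmax_ge_id. Qed.

Lemma le_max_corr k j : cabs (ipm xi (resid phi f0 (G k)) (phi j)) <= max_corr k.
Proof. exact: le_bigmax. Qed.

(** The competitor that adds [z] times the new element to [G k] is supported on the enlarged
    selection; since the element has norm at most 1, it lowers the energy by at least |z|^2, and the
    weak greedy choice bounds |z| below by [t * max_corr k]. *)
Lemma energy_step k : energy k.+1 <= energy k - (t * max_corr k) ^+ 2.
Proof.
set z := ipm xi (resid phi f0 (G k)) (phi (sel k)).
have tz : (t * max_corr k) ^+ 2 <= cabs z ^+ 2.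
  rewrite lerXn2r ?nnegrE ?cabs_ge0 ?mulr_ge0 ?max_corr_ge0 //.
  exact: sel_run (G_proj k).
pose w j := G k j - (- z) * (j == sel k)%:R.
have wS : supported_on w (S k.+1).
  move=> j; rewrite selectedS !inE negb_or => /andP[/negbTE jk jS].
  by rewrite /w jk mulr0 subr0 (proj1 (G_proj k)).
apply: le_trans (proj_resid_min (G_proj k.+1) wS) _.
rewrite (@eq_normm_sqr _ _ _ _ _
  (fun x => resid phi f0 (G k) x - z * phi (sel k) x)); last first.
  by move=> x; rewrite /resid lincombB lincombZ lincomb_delta; ring.
rewrite normm_sqr_subZ -/z -/(energy k).
have -> : complex.Re (conjc z * z) = cabs z ^+ 2.
  by rewrite cabs_sqr; case: (z) => a b /=; ring.
have := phi_le1 (sel k); have := sqr_ge0 (cabs z); nra.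
Qed.

Lemma energy_mono k l : (k <= l)%N -> energy l <= energy k.
Proof.
move=> /subnK <-; elim: (l - k)%N => [|n IHn]; first by rewrite add0n.
by rewrite addSn (le_trans (energy_step _)) // (le_trans _ IHn) // gerBl sqr_ge0.
Qed.

(* Young's inequality [M |w_j| <= M^2 / (2 alpha) + alpha |w_j|^2 / 2], summed over the at most s
   new indices, replaces Cauchy-Schwarz and leaves a term absorbed by |lincomb (w - G k)|^2 / 2. *)
Lemma corr_lower k (w : 'I_N -> R[i]) (A T : {set 'I_N}) :
  supported_on (fun j => w j - G k j) T -> (#|T| <= u)%N ->
  (forall j, j \notin S k -> j \notin A -> w j = 0) ->
  alpha * (energy k - normm_sqr xi (resid phi f0 w)) <= #|A|%:R * max_corr k ^+ 2.
Proof.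
move=> wT uT wA; set r := resid phi f0 (G k); pose e j := w j - G k j.
have := sparse_lower uT wT; rewrite -/e => lowe.
have -> : normm_sqr xi (resid phi f0 w) =
  normm_sqr xi (fun x => r x - 1 * lincomb phi e x).
  by apply: eq_normm_sqr => x; rewrite /r /e /resid lincombB; ring.
rewrite normm_sqr_subZ -/(energy k) conjc1 mul1r cabs1 expr1n mul1r.
set D := normm_sqr xi (lincomb phi e) in lowe *.
suff : 2 * alpha * complex.Re (ipm xi r (lincomb phi e)) <=
       #|A|%:R * max_corr k ^+ 2 + alpha * (alpha * coef_sqr e [set: 'I_N]).
  by move=> H; have := alpha_gt0; nra.
have HA : coef_sqr e A <= coef_sqr e [set: 'I_N] by rewrite coef_sqr_subset // finset.subsetT.
apply: (@le_trans _ _ (#|A|%:R * max_corr k ^+ 2 + alpha * (alpha * coef_sqr e A))); last first.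
  by rewrite lerD2l !ler_wpM2l // ltW.
rewrite (proj_resid_orth _ (G_proj k)) Re_sum mulr_sumr.
(* Orthogonality has discarded the indices of [S k]; outside both [S k] and [A], [w] and [G k]
   vanish. *)
rewrite (_ : \sum_(j in _) _ = \sum_(j in A | j \notin S k)
  2 * alpha * complex.Re (conjc (e j) * ipm xi r (phi j))); last first.
  rewrite (bigID (mem A)) /= [X in _ + X]big1 ?addr0; last first.
    move=> j; rewrite inE => /andP[jS jA].
    by rewrite /e wA // (proj1 (G_proj k)) // subrr conjc0 mul0r mulr0.
  by apply: eq_bigl => j; rewrite inE andbC.
rewrite -sum1_card natr_sum mulr_suml /coef_sqr !mulr_sumr -big_split /=.
rewrite [leRHS](bigID (mem (~: S k))) /= -[leLHS]addr0 lerD //; last first.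
  apply: sumr_ge0 => j _; rewrite mul1r addr_ge0 ?sqr_ge0 //.
  by rewrite mulr_ge0 ?(ltW alpha_gt0) // mulr_ge0 ?(ltW alpha_gt0) // sqr_ge0.
under [leRHS]eq_bigl do rewrite inE.
apply: ler_sum => j _; rewrite mul1r.
have h1 := Re_le_cabs (conjc (e j) * ipm xi r (phi j)).
rewrite cabsM cabs_conj in h1.
have h2 : cabs (e j) * cabs (ipm xi r (phi j)) <= cabs (e j) * max_corr k.
  by rewrite ler_wpM2l ?cabs_ge0 // le_max_corr.
have h3 : 2 * alpha * complex.Re (conjc (e j) * ipm xi r (phi j)) <=
    2 * alpha * (cabs (e j) * max_corr k).
  by rewrite ler_wpM2l ?(le_trans h1 h2) // mulr_ge0 // ltW.
apply: le_trans h3 _; have := sqr_ge0 (alpha * cabs (e j) - max_corr k); nra.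
Qed.

Lemma energy_decrease k (w : 'I_N -> R[i]) (A T : {set 'I_N}) :
  supported_on (fun j => w j - G k j) T -> (#|T| <= u)%N ->
  (forall j, j \notin S k -> j \notin A -> w j = 0) ->
  t ^+ 2 * alpha * (energy k - normm_sqr xi (resid phi f0 w)) <=
    #|A|%:R * (energy k - energy k.+1).
Proof.
move=> wT uT wA; have h := corr_lower wT uT wA.
have := energy_step k; rewrite exprMn => h2.
rewrite -mulrA (le_trans (ler_wpM2l (sqr_ge0 t) h)) // mulrCA ler_wpM2l //; lra.
Qed.

(** Up to time [l] the energy is at least [energy l], so its excess over the error of [w] is at
    least half of [energy l]; adding up the [l - k] resulting drops telescopes. The factor [#|A|]
    stays on the right, so [A] may be empty. *)
Lemma energy_decay k l (w : 'I_N -> R[i]) (A T : {set 'I_N}) :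
  supported_on w T -> (#|T| + l <= u)%N -> (k <= l)%N ->
  (forall j, j \notin S k -> j \notin A -> w j = 0) ->
  2 * normm_sqr xi (resid phi f0 w) <= energy l ->
  t ^+ 2 * alpha * (l - k)%:R * energy l <= 2 * #|A|%:R * energy k.
Proof.
move=> wT uT kl wA El.
have ta : 0 <= t ^+ 2 * alpha by rewrite mulr_ge0 ?sqr_ge0 ?(ltW alpha_gt0).
suff H n : (n <= l - k)%N ->
    t ^+ 2 * alpha * n%:R * energy l <= 2 * #|A|%:R * (energy k - energy (k + n)).
  apply: le_trans (H _ (leqnn _)) _; rewrite ler_wpM2l ?mulr_ge0 ?ler0n //.
  by rewrite gerBl energy_ge0.
elim: n => [|n IHn] nl; first by rewrite mulr0 mul0r addn0 subrr mulr0.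
have kn : (k + n <= l)%N by rewrite -leq_subRL // ltnW.
have wG : supported_on (fun j => w j - G (k + n) j) (T :|: S (k + n)).
  apply: supported_onB; first exact: supported_on_sub (finset.subsetUl _ _) wT.
  exact: supported_on_sub (finset.subsetUr _ _) (proj1 (G_proj _)).
have wA' j : j \notin S (k + n) -> j \notin A -> w j = 0.
  move=> jS; apply: wA; apply: contra jS.
  exact: (fintype.subsetP (selected_mono (leq_addr n k))).
have cT : (#|T :|: S (k + n)| <= u)%N.
  rewrite (leq_trans _ uT) // (leq_trans (leq_card_setU _ _)) // leq_add2l.
  exact: leq_trans (card_selected _) kn.
have h := energy_decrease wG cT wA'.
have h0 := IHn (ltnW nl); have h1 := energy_mono kn.
have h2 : t ^+ 2 * alpha * energy l <=
    2 * (t ^+ 2 * alpha * (energy (k + n) - normm_sqr xi (resid phi f0 w))).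
  by rewrite [leRHS]mulrCA ler_wpM2l //; lra.
rewrite addnS -natr1; lra.
Qed.

(* If at least s of the n missing indices of T are selected within c * s steps, for some s, the
   induction hypothesis applies.  Otherwise, writing E s for the error of the best approximation
   using s missing indices, the coefficients not captured after c * s.+1 steps bound E s by the
   energy at that time, which is much smaller than the energy at time c * s./2; descending from
   s = n to s = 0 yields 2 * E 0 <= energy k <= E 0, a contradiction. *)
Lemma energy_le_error (c n k : nat) (a : 'I_N -> R[i]) (T : {set 'I_N}) :
  192 * beta <= c%:R * t ^+ 2 * alpha ^+ 2 -> supported_on a T ->
  (#|T| + (k + c * n) <= u)%N -> (#|T :\: S k| <= n)%N ->
  energy (k + c * n) <= 8 * normm_sqr xi (resid phi f0 a).
Proof.
move=> c_large aT; have [n0] := ubnP n; elim: n0 n k => // n0 IH n k; rewrite ltnS => nn0 uT Tn.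
set h2 := normm_sqr xi _; have h2_ge0 : 0 <= h2 by exact: normm_sqr_ge0.
rewrite leNgt; apply/negP => big.
have big_at j : (j <= n)%N -> 8 * h2 < energy (k + c * j).
  by move=> jn; rewrite (lt_le_trans big) // energy_mono // leq_add2l leq_mul2l jn orbT.
(* With at most [n - s.+1] missing indices at time [k + c * s.+1], the induction hypothesis
   restarted there would contradict [big]. *)
have late s : (s < n)%N -> (n - s.+1 < #|T :\: S (k + c * s.+1)|)%N.
  move=> sn; rewrite ltnNge; apply/negP => le_ns.
  have e : (k + c * s.+1 + c * (n - s.+1) = k + c * n)%N.
    by rewrite -addnA -mulnDr subnKC.
  have lt_n0 : (n - s.+1 < n0)%N by lia.
  by have := IH _ (k + c * s.+1)%N lt_n0; rewrite e leNgt big => /(_ uT le_ns).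
(* [U] holds the missing indices, [A s] an optimal choice of at most [s] of them, and [rest (A s)]
   the squared coefficients left out by the target [w s]. *)
pose U := T :\: S k; pose rest A := coef_sqr a (U :\: A).
pose A s := [arg min_(A < finset.set0 | (#|A| <= s)%N) rest A]%O.
have AP s : (#|A s| <= s)%N /\ forall B : {set 'I_N}, (#|B| <= s)%N -> rest (A s) <= rest B.
  by rewrite /A; case: arg_minP => [|B Bs Bmin]; rewrite ?cards0.
pose w s j := if j \in S k :|: A s then a j else 0.
pose E s := normm_sqr xi (resid phi f0 (w s)).
have wT s : supported_on (w s) T by move=> j /aT aj; rewrite /w aj if_same.
have UT : U \subset T by rewrite finset.subsetDl.
have E_le s : E s <= 2 * h2 + 2 * (beta * rest (A s)).
  have awU : supported_on (fun j => a j - w s j) (U :\: A s).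
    move=> j; rewrite /w !inE negb_and negbK negb_and negbK.
    case: ifP => [_|/negbT]; first by rewrite subrr.
    by rewrite negb_or => /andP[/negbTE -> /negbTE ->] /= /aT ->; rewrite subrr.
  have -> : rest (A s) = coef_sqr (fun j => a j - w s j) [set: 'I_N].
    rewrite /rest /coef_sqr [RHS](bigID (mem (U :\: A s))) /= [X in _ + X]big1 ?addr0; last first.
      by move=> j /andP[_ /awU ->]; rewrite cabs0 expr0n.
    apply: eq_big => [j|j]; first by rewrite !inE.
    rewrite !inE /w !inE => /and3P[/negbTE -> /negbTE -> _] /=.
    by rewrite subr0.
  have -> : E s = normm_sqr xi (fun x => resid phi f0 a x + lincomb phi (fun j => a j - w s j) x).
    by apply: eq_normm_sqr => x; rewrite /resid lincombB; ring.
  apply: le_trans (normm_sqrD_le _ _ _) _; rewrite lerD2l ler_wpM2l //.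
  apply: sparse_upper awU; rewrite (leq_trans _ uT) // (leq_trans _ (leq_addr _ _)) //.
  by rewrite subset_leq_card // (fintype.subset_trans (finset.subsetDl _ _)).
have E_last s : (n <= s)%N -> E s <= 2 * h2.
  move=> ns; have := E_le s; have := (AP s).2 U (leq_trans Tn ns).
  rewrite {2}/rest finset.setDv /coef_sqr big_set0 => r0.
  have := mulr_ge0_le0 beta_ge0 r0; lra.
(* By [late], at most [s] indices of [U] are selected by time [l], so they compete with [A s]. The
   indices still missing have coefficient 0 in [G l], hence are controlled by [a - G l]; finally
   [2 * energy l + 2 * h2 <= 3 * energy l], because [8 * h2 < energy l]. *)
have rest_le s : (s < n)%N -> alpha * rest (A s) <= 3 * energy (k + c * s.+1).
  move=> sn; set l := (k + c * s.+1)%N.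
  have kl : (k <= l)%N by rewrite leq_addr.
  have UE : U :\: (U :&: S l) = T :\: S l.
    apply/finset.setP => j; rewrite !inE; have := fintype.subsetP (selected_mono kl) j.
    case: (j \in S k) => [/(_ isT) ->|_] /=; first by rewrite ?andbF.
    by case: (j \in S l); case: (j \in T).
  have : rest (A s) <= coef_sqr a (T :\: S l).
    rewrite -UE; apply: (AP s).2.
    have := cardsID (S l) U; have := late s sn; rewrite -/l -UE finset.setDIr finset.setDv finset.set0U.
    move: Tn; rewrite -/U; lia.
  move=> rs.
  have aG : supported_on (fun j => a j - G l j) (T :|: S l).
    apply: supported_onB; first exact: supported_on_sub (finset.subsetUl _ _) aT.
    exact: supported_on_sub (finset.subsetUr _ _) (proj1 (G_proj _)).
  have cT : (#|T :|: S l| <= u)%N.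
    rewrite (leq_trans _ uT) // (leq_trans (leq_card_setU _ _)) // leq_add2l.
    by rewrite (leq_trans (card_selected _)) // leq_add2l leq_mul2l sn orbT.
  have lo := sparse_lower cT aG.
  have : coef_sqr a (T :\: S l) <= coef_sqr (fun j => a j - G l j) [set: 'I_N].
    apply: le_trans (coef_sqr_subset _ (finset.subsetT (T :\: S l))).
    rewrite /coef_sqr ler_sum // => j; rewrite inE => /andP[jS _].
    by rewrite (proj1 (G_proj l)) // subr0.
  move=> /(le_trans rs) rs2.
  have : normm_sqr xi (lincomb phi (fun j => a j - G l j)) <= 2 * energy l + 2 * h2.
    have -> : normm_sqr xi (lincomb phi (fun j => a j - G l j)) =
       normm_sqr xi (fun x => resid phi f0 (G l) x + (-1) * resid phi f0 a x).
      by apply: eq_normm_sqr => x; rewrite lincombB /resid; ring.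
    apply: le_trans (normm_sqrD_le _ _ _) _; rewrite lerD2l ler_wpM2l //.
    rewrite (_ : normm_sqr _ _ = h2) //; congr (_ * _); apply: eq_bigr => j _.
    by rewrite cabsM cabsN cabs1 mul1r.
  have := big_at s.+1 sn; rewrite -/l.
  have := ler_wpM2l (ltW alpha_gt0) rs2; lra.
(* Downward induction on [s]: the claim for [s] follows from the one for about [2 * s]. *)
have E_half s : (s <= n)%N -> 2 * E s <= energy (k + c * s./2).
  have [r] := ubnP (n - s); elim: r s => // r IHr s; rewrite ltnS => nsr sn.
  have s2s : (s./2 <= s)%N by clear; lia.
  have s2n := leq_trans s2s sn.
  have b0 := big_at _ s2n.
  have [ns|] := leqP n s; first by have := E_last _ ns; lra.
  move=> {}sn.
  (* Half of [s.*2.+2] is exactly [s.+1], so the induction hypothesis speaks of time [k + c * s.+1];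
     if [s.*2.+2] reaches [n], then [q = n] and [E_last] is enough. *)
  have [q [qs Eq]] : exists q, (q <= s.*2.+2)%N /\ 2 * E q <= energy (k + c * s.+1).
    have [qn|qn] := leqP n s.*2.+2.
      by exists n; split=> //; have := E_last _ (leqnn n); have := big_at _ sn; lra.
    exists s.*2.+2; split=> //; have := IHr s.*2.+2; rewrite /= doubleK.
    by apply; [move: nsr sn; clear; lia | exact: ltnW].
  have lu : (#|T| + (k + c * s.+1) <= u)%N.
    by rewrite (leq_trans _ uT) // !leq_add2l leq_mul2l sn orbT.
  have kl : (k + c * s./2 <= k + c * s.+1)%N.
    by rewrite leq_add2l leq_mul2l (leq_trans s2s (leqnSn s)) orbT.
  have wA j : j \notin S (k + c * s./2) -> j \notin A q -> w q j = 0.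
    move=> jS jA; rewrite /w inE (negbTE jA) orbF ifN //; apply: contra jS.
    exact: (fintype.subsetP (selected_mono (leq_addr _ k))).
  have dec := energy_decay (wT q) lu kl wA Eq.
  set p0 := energy (k + c * s./2) in dec b0 *; set p1 := energy (k + c * s.+1) in dec Eq.
  have p0_ge0 : 0 <= p0 by exact: energy_ge0.
  have p1_ge0 : 0 <= p1 by exact: energy_ge0.
  have Aq : #|A q|%:R <= 2 * s.+1%:R :> R.
    rewrite -natrM ler_nat (leq_trans (AP q).1) // (leq_trans qs) //.
    by rewrite mul2n doubleS.
  have steps : c%:R * s.+1%:R <= 2 * (k + c * s.+1 - (k + c * s./2))%:R :> R.
    rewrite -!natrM ler_nat subnDl -mulnBr mulnCA leq_mul2l; apply/orP; right.
    clear; lia.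
  have ta : 0 <= t ^+ 2 * alpha by rewrite mulr_ge0 ?sqr_ge0 ?(ltW alpha_gt0).
  (* [energy_decay] between times [k + c * s./2] and [k + c * s.+1]: at least [c * s.+1 / 2] steps
     towards a target with at most [2 * s.+1] missing indices. *)
  have ratio : c%:R * t ^+ 2 * alpha * p1 <= 8 * p0.
    rewrite -(@ler_pM2r _ s.+1%:R) ?ltr0n //.
    have := ler_wpM2r p0_ge0 Aq.
    have := ler_wpM2l (mulr_ge0 ta p1_ge0) steps.
    move: dec; set z := (_ - _)%N%:R; lra.
  have r1 := rest_le s sn; rewrite -/p1 in r1.
  (* This fixes the constant 192 = 2 * 8 * 12: 8 comes from [ratio], 12 = 4 * 3 from [rest_le], 2
     from the half on the right. *)
  have e1 : 4 * beta * rest (A s) <= p0 / 2.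
    rewrite -(ler_pM2l alpha_gt0).
    have := ler_wpM2l (ltW alpha_gt0) ratio.
    have := ler_wpM2r p1_ge0 c_large.
    have := ler_wpM2l beta_ge0 r1; lra.
  have := E_le s; lra.
(* [A 0] is empty, so [w 0] is supported on [S k] and cannot beat the projection [G k]. *)
have E0 : energy k <= E 0%N.
  apply: proj_resid_min (G_proj k) _ => j jS; rewrite /w inE (negbTE jS) /=.
  have := (AP 0%N).1; rewrite leqn0 cards_eq0 => /eqP ->; by rewrite inE.
have := E_half 0%N (leq0n _); have := big_at 0%N (leq0n _); rewrite muln0 addn0; lra.
Qed.

End GreedyResiduals.

(** * Measurability, integrability and comparison of integrals on a compact set *)

Section LpNorms.
Variables (R : realType) (d : nat) (Om : set 'rV[R]_d).
Hypothesis compact_Om : compact Om.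
Implicit Types f g h : 'rV[R]_d -> R[i].

Lemma measurable_compact : measurable (Om : set (Rd R d)).
Proof.
have cOm : closed Om by apply: compact_closed => //; exact: norm_hausdorff.
rewrite -[Om]setCK; apply: measurableC; apply: sub_sigma_algebra.
exact: closed_openC.
Qed.

(** Preimages of open intervals are traces on [Om] of open sets, and [Om] itself is measurable. *)
Lemma measurable_fun_within_continuous (g : 'rV[R]_d -> R) :
  {within Om, continuous g} -> measurable_fun (Om : set (Rd R d)) (g : Rd R d -> R).
Proof.
move=> /continuousP cg.
apply: (measurability _ (measurable_realfun.RGenOpens.measurableE R)).
move=> _ [_ [a [b ->] <-]].
have /open_subspaceP [V oV VD] := cg _ (@interval_open _ (BRight a) (BLeft b) isT isT).
rewrite setIC -VD; apply: measurableI; last exact: measurable_compact.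
exact: sub_sigma_algebra.
Qed.

Lemma within_continuous_cabs f : ccont_on Om f -> {within Om, continuous (fun x => cabs (f x))}.
Proof.
move=> [cr ci] x; apply: continuous_comp; last exact: sqrt_continuous.
apply: cvgD; rewrite expr2; apply: cvgM; by [exact: cr | exact: ci].
Qed.

Lemma ccont_onD f g : ccont_on Om f -> ccont_on Om g -> ccont_on Om (fun x => f x + g x).
Proof.
move=> [fr fi] [gr gi]; split=> x.
- rewrite (_ : (fun x => _) = (fun x => complex.Re (f x) + complex.Re (g x))).
    by apply: cvgD; [exact: fr | exact: gr].
  by apply/funext => y; case: (f y) (g y) => ? ? [].
- rewrite (_ : (fun x => _) = (fun x => complex.Im (f x) + complex.Im (g x))).
    by apply: cvgD; [exact: fi | exact: gi].
  by apply/funext => y; case: (f y) (g y) => ? ? [].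
Qed.

Lemma ccont_onZ (z : R[i]) f : ccont_on Om f -> ccont_on Om (fun x => z * f x).
Proof.
move=> [fr fi]; split=> x.
- rewrite (_ : (fun x => _) = (fun x => complex.Re z * complex.Re (f x) -
      complex.Im z * complex.Im (f x))).
    by apply: cvgB; apply: cvgM; [exact: cvg_cst | exact: fr | exact: cvg_cst | exact: fi].
  by apply/funext => y; case: z (f y) => ? ? [].
- rewrite (_ : (fun x => _) = (fun x => complex.Re z * complex.Im (f x) +
      complex.Im z * complex.Re (f x))).
    by apply: cvgD; apply: cvgM; [exact: cvg_cst | exact: fi | exact: cvg_cst | exact: fr].
  by apply/funext => y; case: z (f y) => a b [a' b'] /=; ring.
Qed.

Lemma ccont_on_lincomb N (phi : 'I_N -> 'rV[R]_d -> R[i]) a :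
  (forall j, ccont_on Om (phi j)) -> ccont_on Om (lincomb phi a).
Proof.
move=> cphi; rewrite /lincomb; elim: (index_enum _) => [|j s IHs].
  by split=> x; under eq_fun do rewrite big_nil; exact: cvg_cst.
under eq_fun do rewrite big_cons.
by apply: ccont_onD => //; exact: ccont_onZ.
Qed.

Lemma ccont_on_resid N (phi : 'I_N -> 'rV[R]_d -> R[i]) f a :
  ccont_on Om f -> (forall j, ccont_on Om (phi j)) -> ccont_on Om (resid phi f a).
Proof.
move=> cf cphi; rewrite /resid; under eq_fun do rewrite -mulN1r.
by apply: ccont_onD => //; apply: ccont_onZ; exact: ccont_on_lincomb.
Qed.

Lemma integrable_cabs_powR (mu : {finite_measure set (Rd R d) -> \bar R}) f p : 0 < p ->
  ccont_on Om f -> mu.-integrable Om (EFin \o (fun x => cabs (f x) `^ p)).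
Proof.
move=> p0 cf; have cc := within_continuous_cabs cf.
apply: measurable_bounded_integrable; first exact: measurable_compact.
- by rewrite ltey_eq fin_num_measure //; exact: measurable_compact.
- apply: (measurableT_comp (measurable_realfun.measurable_powR p)).
  exact: measurable_fun_within_continuous.
- have /compact_bounded [M [_ HM]] := continuous_compact cc compact_Om.
  exists ((M + 1) `^ p); split; first exact: num_real.
  move=> y My x /= Ox; rewrite (le_trans _ (ltW My)) // ger0_norm ?powR_ge0 //.
  have fM : cabs (f x) <= M + 1.
    have := HM (M + 1); rewrite ltrDl ltr01 => /(_ isT (cabs (f x))) H.
    by rewrite (le_trans (ler_norm _)) // H //; exists x.
  have f0 := cabs_ge0 (f x).
  by rewrite ge0_ler_powR ?(ltW p0) ?nnegrE // (le_trans f0).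
Qed.

Definition powint (mu : {measure set (Rd R d) -> \bar R}) p f : R :=
  (\int[mu]_(x in Om) (cabs (f x) `^ p))%R.

Lemma normLpE mu p f : normLp mu Om p f = powint mu p f `^ p^-1.
Proof. by []. Qed.

Lemma powint_ge0 mu p f : 0 <= powint mu p f.
Proof. by apply: Rintegral_ge0 => x _; exact: powR_ge0. Qed.

(** One integrated pointwise bound serves twice: with [c2 = 0] as a substitute for Jensen's
    inequality, with [c0 = 0] for Minkowski's. *)
Lemma powint_le (mu : {finite_measure set (Rd R d) -> \bar R}) p q r c0 c1 c2 f g h :
  0 < p -> 0 < q -> 0 < r -> ccont_on Om f -> ccont_on Om g -> ccont_on Om h ->
  (forall x, Om x -> cabs (f x) `^ p <= c0 + (c1 * cabs (g x) `^ q + c2 * cabs (h x) `^ r)) ->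
  powint mu p f <= c0 * fine (mu Om) + (c1 * powint mu q g + c2 * powint mu r h).
Proof.
move=> p0 q0 r0 cf cg ch le_fgh.
have mOm := measurable_compact.
have If := integrable_cabs_powR mu p0 cf.
have Ig := integrable_cabs_powR mu q0 cg.
have Ih := integrable_cabs_powR mu r0 ch.
have I0 : mu.-integrable Om (EFin \o cst c0).
  apply: measurable_bounded_integrable => //; first by rewrite ltey_eq fin_num_measure.
  exists `|c0|; split; first exact: num_real.
  by move=> y cy x _ /=; exact: ltW.
have Ig' : mu.-integrable Om (EFin \o (fun x => c1 * cabs (g x) `^ q)).
  exact: (integrableZl mOm c1 Ig).
have Ih' : mu.-integrable Om (EFin \o (fun x => c2 * cabs (h x) `^ r)).
  exact: (integrableZl mOm c2 Ih).
have Igh : mu.-integrable Om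
    (EFin \o (fun x => c1 * cabs (g x) `^ q + c2 * cabs (h x) `^ r)).
  exact: (integrableD mOm Ig' Ih').
rewrite /powint -(Rintegral_cst mu mOm) -(RintegralZl c1 mOm Ig) -(RintegralZl c2 mOm Ih).
rewrite -(RintegralD mOm Ig' Ih') -(RintegralD mOm I0 Igh).
apply: le_Rintegral => //; exact: (integrableD mOm I0 Igh).
Qed.

End LpNorms.

(** * Pointwise inequalities between powers *)

Section PowerInequalities.
Variable R : realType.
Implicit Types e x y p : R.

(** Below the threshold [e] the first term suffices; above it, y^(2-p) <= e^(2-p) since the exponent
    is nonpositive. *)
Lemma sqr_le_powR e y p : 0 < e -> 0 <= y -> 2 <= p ->
  y ^+ 2 <= e ^+ 2 + e `^ (2 - p) * y `^ p.
Proof.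
move=> e0 y_ge0 p2; have [ye|ey] := leP y e.
  rewrite -[leLHS]addr0 lerD ?mulr_ge0 ?powR_ge0 //.
  by rewrite lerXn2r // nnegrE ltW.
have y_gt0 : 0 < y by exact: lt_trans ey.
rewrite -[leLHS]add0r lerD ?sqr_ge0 //.
rewrite -(@ler_pM2l _ (e `^ (p - 2))) ?powR_gt0 // [leRHS]mulrA -powRD; last first.
  by rewrite (gt_eqF e0) implybT.
have -> : y `^ p = y `^ (p - 2) * y ^+ 2.
  by rewrite -(powR_mulrn 2 y_ge0) -powRD ?subrK // (gt_eqF y_gt0) implybT.
rewrite addrA subrK subrr powRr0 mul1r ler_wpM2r ?sqr_ge0 //.
by rewrite ge0_ler_powR ?nnegrE ?subr_ge0 // ltW.
Qed.

(** The sum is at most twice the larger of [x] and [y]. *)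
Lemma powRD_le x y p : 0 <= x -> 0 <= y -> 0 <= p ->
  (x + y) `^ p <= 2 `^ p * x `^ p + 2 `^ p * y `^ p.
Proof.
wlog xy : x y / x <= y.
  move=> H x0 y0 p0; have [xy|/ltW yx] := leP x y; first exact: H.
  by rewrite addrC [leRHS]addrC H.
move=> x0 y0 p0; rewrite -!powRM //.
rewrite -[leLHS]add0r lerD ?powR_ge0 // ge0_ler_powR ?nnegrE ?addr_ge0 ?mulr_ge0 //; lra.
Qed.

End PowerInequalities.

(** * Norms with respect to [mu], the sample mean and [mu_xi] *)

Section SampledMeasure.
Variables (R : realType) (d m : nat) (Om : set 'rV[R]_d).
Variables (mu : probability (Rd R d) R) (xi : 'I_m -> 'rV[R]_d).
Hypotheses (compact_Om : compact Om) (mu_Om : mu Om = 1%E) (Om_xi : forall j, Om (xi j)).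
Implicit Types f g h : 'rV[R]_d -> R[i].

Definition powmean p f : R := (m%:R)^-1 * \sum_(j < m) cabs (f (xi j)) `^ p.

Lemma powmean_ge0 p f : 0 <= powmean p f.
Proof. by rewrite mulr_ge0 ?inv_natr_ge0 // sumr_ge0 // => j _; exact: powR_ge0. Qed.

(** Both terms on the right are nonnegative, so each is at most twice the [mu_xi] integral. *)
Lemma powint_mu_xi p f : 0 < p -> ccont_on Om f ->
  powint Om (mu_xi mu xi) p f = 2^-1 * (powint Om mu p f + powmean p f).
Proof.
move=> p0 cf; have mOm := measurable_compact compact_Om.
have If := integrable_cabs_powR compact_Om mu p0 cf.
have mf := measurable_int _ If.
have f0 x : Om x -> (0 <= (cabs (f x) `^ p)%:E)%E.
  by move=> _; rewrite lee_fin powR_ge0.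
rewrite /powint /Rintegral /mu_xi.
rewrite ge0_integral_mscale // ge0_integral_measure_add //.
rewrite /mu_m ge0_integral_mscale // ge0_integral_measure_sum //.
(* [valK] resolves the [insub] in [mu_m]: every index below [m] contributes its Dirac mass. *)
rewrite (eq_bigr (fun j : 'I_m => (cabs (f (xi j)) `^ p)%:E)); last first.
  by move=> j _; rewrite valK integral_dirac // diracE mem_set // mul1e.
rewrite sumEFin.
have fin : (\int[mu]_(x in Om) (cabs (f x) `^ p)%:E)%E \is a fin_num.
  exact: integrable_fin_num If.
by rewrite -(fineK fin).
Qed.

(** Averaging [sqr_le_powR] at threshold [e] gives e^2 + e^(2-p) * 2 e^p = 3 e^2. *)
Lemma normm_sqr_le_powmean p e f : 0 < e -> 2 <= p ->
  powmean p f <= 2 * e `^ p -> normm_sqr xi f <= 3 * e ^+ 2.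
Proof.
move=> e0 p2 fe.
have ee : e `^ (2 - p) * e `^ p = e ^+ 2.
  by rewrite -powRD ?subrK ?(gt_eqF e0) ?implybT // powR_mulrn // ltW.
apply: (@le_trans _ _ ((m%:R)^-1 * (m%:R * e ^+ 2) + e `^ (2 - p) * powmean p f)).
  rewrite /powmean [X in _ + X]mulrCA -mulrDr ler_wpM2l ?inv_natr_ge0 //.
  rewrite mulr_natl -[X in _ *+ X]card_ord -sumr_const mulr_sumr -big_split /=.
  by apply: ler_sum => j _; apply: sqr_le_powR; rewrite ?cabs_ge0.
have h1 : (m%:R)^-1 * (m%:R * e ^+ 2) <= e ^+ 2.
  have [->|m0] := eqVneq (m%:R : R) 0; first by rewrite mul0r mulr0 sqr_ge0.
  by rewrite mulKf.
have := ler_wpM2l (powR_ge0 e (2 - p)) fe; rewrite [in leRHS]mulrCA ee; lra.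
Qed.

Lemma powR_normLp (nu : {measure set (Rd R d) -> \bar R}) p f : 0 < p ->
  normLp nu Om p f `^ p = powint Om nu p f.
Proof.
by move=> p0; rewrite normLpE -powRrM mulVf ?gt_eqF // powRr1 // powint_ge0.
Qed.

Lemma normLp_le (nu : {measure set (Rd R d) -> \bar R}) p f x : 0 < p -> 0 <= x ->
  powint Om nu p f <= x `^ p -> normLp nu Om p f <= x.
Proof.
move=> p0 x0 le_fx; rewrite normLpE -[leRHS](@powRr1 _ x) // -(@mulfV _ p) ?gt_eqF //.
by rewrite powRrM ge0_ler_powR ?nnegrE ?powR_ge0 ?powint_ge0 // invr_ge0 ltW.
Qed.

(** Integrating [sqr_le_powR] over a set of mass 1 bounds the squared L_2 norm by 2 e^2, which is
    below (2 e)^2. *)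
Lemma normL2_le_normLp p e f : 0 < e -> 2 <= p -> ccont_on Om f ->
  normLp mu Om p f <= e -> normLp mu Om 2 f <= 2 * e.
Proof.
move=> e0 p2 cf fe; have p0 : 0 < p by exact: lt_le_trans p2.
apply: normLp_le => //; first by rewrite mulr_ge0 // ltW.
have := @powint_le _ _ _ compact_Om mu 2 p p (e ^+ 2) (e `^ (2 - p)) 0 f f f.
move=> /(_ _ p0 p0 cf cf cf) H; apply: le_trans (H _ _) _ => //.
  move=> x _; rewrite mul0r addr0 powR_mulrn ?cabs_ge0 //.
  by apply: sqr_le_powR; rewrite ?cabs_ge0.
rewrite [fine _](_ : _ = 1); last exact: (congr1 fine mu_Om).
rewrite mulr1 mul0r addr0 -powR_normLp // powR_mulrn ?mulr_ge0 ?(ltW e0) //.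
have : e `^ (2 - p) * normLp mu Om p f `^ p <= e `^ (2 - p) * e `^ p.
  by rewrite ler_wpM2l ?powR_ge0 // ge0_ler_powR ?nnegrE ?powR_ge0 // ltW.
rewrite -powRD ?subrK ?(gt_eqF e0) ?implybT // powR_mulrn ?(ltW e0) //.
have := sqr_ge0 e; lra.
Qed.

(** By [powRD_le] the integral is at most 2^p (2 e^p + (K e)^p) <= 2^p * 3 (K e)^p, and 3 <= 3^p
    makes this at most (6 K e)^p. *)
Lemma normLpD_le p K e f g : 0 < e -> 2 <= p -> 1 <= K -> ccont_on Om f -> ccont_on Om g ->
  powint Om mu p f <= 2 * e `^ p -> normLp mu Om p g <= K * e ->
  normLp mu Om p (fun x => f x + g x) <= 6 * K * e.
Proof.
move=> e0 p2 K1 cf cg fe ge; have p0 : 0 < p by exact: lt_le_trans p2.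
have K0 : 0 <= K by exact: le_trans K1.
have Ke0 : 0 <= K * e by rewrite mulr_ge0 // ltW.
apply: normLp_le => //; first by rewrite -mulrA mulr_ge0.
have := @powint_le _ _ _ compact_Om mu p p p 0 (2 `^ p) (2 `^ p) (fun x => f x + g x) f g.
move=> /(_ p0 p0 p0 (ccont_onD cf cg) cf cg) H; apply: le_trans (H _) _.
  move=> x _; rewrite add0r; apply: le_trans _ (powRD_le _ _ _); rewrite ?cabs_ge0 ?(ltW p0) //.
  by rewrite ge0_ler_powR ?nnegrE ?addr_ge0 ?cabs_ge0 ?cabsD_le // ltW.
have -> : (6 * K * e) `^ p = 2 `^ p * (3 `^ p * (K * e) `^ p).
  by rewrite -!powRM ?(mulr_ge0 _ Ke0) //; congr (_ `^ _); ring.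
rewrite mul0r add0r -mulrDr ler_wpM2l ?powR_ge0 //.
have h1 : e `^ p <= (K * e) `^ p.
  by rewrite ge0_ler_powR ?nnegrE ?(ltW p0) ?(ltW e0) // ler_peMl // ltW.
have h2 : powint Om mu p g <= (K * e) `^ p.
  by rewrite -powR_normLp // ge0_ler_powR ?nnegrE ?powR_ge0 ?(ltW p0).
have h3 : 3 <= 3 `^ p :> R.
  by rewrite -[leLHS]powRr1 // ler_powR ?ler1n // (le_trans _ p2) // ler1n.
apply: le_trans (ler_wpM2r (powR_ge0 (K * e) p) h3).
have -> : 3 * (K * e) `^ p = 2 * (K * e) `^ p + (K * e) `^ p by ring.
by rewrite lerD // (le_trans fe) // ler_wpM2l.
Qed.

End SampledMeasure.

(** * Frame bounds for sparse combinations *)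

Lemma subset_of_card (T : finType) (S : {set T}) u : (#|S| <= u)%N -> (u <= #|T|)%N ->
  exists J : {set T}, S \subset J /\ #|J| = u.
Proof.
move=> Su uT; have [n] := ubnP (u - #|S|); elim: n S Su => // n IHn S Su; rewrite ltnS => Sn.
have [uS|Su'] := leqP u #|S|; first by exists S; split=> //; apply/eqP; rewrite eqn_leq Su uS.
have [j jS] : exists j, j \in ~: S.
  by apply/card_gt0P; rewrite cardsCs finset.setCK subn_gt0 (leq_trans Su').
rewrite inE in jS; have cS : #|j |: S| = #|S|.+1 by rewrite cardsU1 jS.
have lt_n : (u - #|S|.+1 < n)%N by lia.
have := IHn (j |: S); rewrite cS => /(_ Su' lt_n) [J [SJ Ju]].
by exists J; split=> //; apply: fintype.subset_trans SJ; exact: finset.subsetUr.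
Qed.

Section SparseFrame.
Variables (R : realType) (d N m u : nat) (mu : probability (Rd R d) R).
Variables (Om : set 'rV[R]_d) (phi : 'I_N -> 'rV[R]_d -> R[i]) (R1 R2 : R).
Variable xi : 'I_m -> 'rV[R]_d.
Hypotheses (R1_gt0 : 0 < R1) (R12 : R1 <= R2) (uN : (u <= N)%N).
Hypotheses (phi_riesz : riesz mu Om phi R1 R2) (phi_usd : L2_usd mu Om phi u xi).

(** The index set in [vterm] has exactly [u] elements, so a smaller support is padded, which
    [u <= N] allows. *)
Lemma vterm_supported (a : 'I_N -> R[i]) (S : {set 'I_N}) :
  (#|S| <= u)%N -> supported_on a S -> @vterm R N u a.
Proof.
move=> Su aS; have [|J [SJ Ju]] := subset_of_card Su; first by rewrite card_ord.
by exists J; split=> //; exact: supported_on_sub aS.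
Qed.

Lemma riesz_sqr (a : 'I_N -> R[i]) :
  R1 ^+ 2 * coef_sqr a [set: 'I_N] <= normLp mu Om 2 (lincomb phi a) ^+ 2 /\
  normLp mu Om 2 (lincomb phi a) ^+ 2 <= R2 ^+ 2 * coef_sqr a [set: 'I_N].
Proof.
have [lo up] := phi_riesz a.
have -> : coef_sqr a [set: 'I_N] = Num.sqrt (\sum_(j < N) cabs (a j) ^+ 2) ^+ 2.
  rewrite sqr_sqrtr; last by apply: sumr_ge0 => j _; rewrite sqr_ge0.
  by apply: eq_bigl => j; rewrite inE.
set q := Num.sqrt _ in lo up *; have q0 : 0 <= q by exact: sqrtr_ge0.
have n0 : 0 <= normLp mu Om 2 (lincomb phi a) by exact: powR_ge0.
rewrite -!exprMn; split; rewrite lerXn2r // nnegrE mulr_ge0 //.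
- exact: ltW.
- by rewrite (le_trans _ R12) // ltW.
Qed.

Lemma sparse_frame_lower (a : 'I_N -> R[i]) (S : {set 'I_N}) :
  (#|S| <= u)%N -> supported_on a S ->
  R1 ^+ 2 / 2 * coef_sqr a [set: 'I_N] <= normm_sqr xi (lincomb phi a).
Proof.
move=> Su aS; have [lo _] := phi_usd (vterm_supported Su aS).
rewrite -/(normm_sqr xi _) in lo; have := (riesz_sqr a).1; lra.
Qed.

Lemma sparse_frame_upper (a : 'I_N -> R[i]) (S : {set 'I_N}) :
  (#|S| <= u)%N -> supported_on a S ->
  normm_sqr xi (lincomb phi a) <= 3 / 2 * R2 ^+ 2 * coef_sqr a [set: 'I_N].
Proof.
move=> Su aS; have [_ up] := phi_usd (vterm_supported Su aS).
rewrite -/(normm_sqr xi _) in up; have := (riesz_sqr a).2; lra.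
Qed.

(* Testing the Nikol'skii inequality on one element of the system. *)
Lemma NI_const_ge p H : compact Om -> mu Om = 1%E -> 2 <= p -> (0 < u)%N ->
  (forall j, ccont_on Om (phi j)) -> NI mu Om phi 2 p H u -> 1 / 4 <= H.
Proof.
move=> cOm muOm p2 u0 cphi ni; have N0 : (0 < N)%N by exact: leq_trans uN.
pose i : 'I_N := Ordinal N0; pose a j : R[i] := (j == i)%:R.
have aS : supported_on a [set i]%SET by move=> j; rewrite inE /a => /negbTE ->.
have := ni a (vterm_supported _ aS); rewrite cards1 => /(_ u0) HA.
have Y2 := (riesz_sqr a).1; set Y := normLp mu Om 2 _ in HA Y2.
have c1 : 1 <= coef_sqr a [set: 'I_N].
  apply: le_trans (coef_sqr_subset _ (finset.subsetT [set i]%SET)).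
  by rewrite /coef_sqr big_set1 /a eqxx cabs1 expr1n.
have Y0 : 0 < Y.
  rewrite lt0r powR_ge0 andbT; apply/eqP => Y0; move: Y2.
  have R1_2 : 0 < R1 ^+ 2 by rewrite exprn_gt0.
  by have := ler_wpM2l (ltW R1_2) c1; rewrite Y0 expr0n /=; lra.
(* If [H < 1/4], the L_p norm is at most [Y / 4], and [normL2_le_normLp] yields [Y <= Y / 2] for a
   positive [Y]. *)
rewrite leNgt; apply/negP => Hlt.
have : normLp mu Om 2 (lincomb phi a) <= 2 * (Y / 4).
  apply: (@normL2_le_normLp _ _ _ _ cOm muOm p); rewrite ?divr_gt0 //.
    exact: ccont_on_lincomb.
  apply: le_trans HA _; have := ler_wpM2r (ltW Y0) (ltW Hlt); lra.
rewrite -/Y; lra.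
Qed.

End SparseFrame.

(** * The two error bounds for the greedy residual *)

Theorem theorem3p1 (R : realType) :
  exists C0 C1 : R, 0 < C0 /\ 0 < C1 /\
  forall t R1 R2 : R, 0 < t -> t <= 1 -> 0 < R1 -> R1 <= R2 ->
  exists c : nat, (1 <= c)%N /\
  forall (d N : nat) (mu : probability (Rd R d) R) (Om : set 'rV[R]_d)
         (p : R) (phi : 'I_N -> 'rV[R]_d -> R[i]) (u m : nat)
         (xi : 'I_m -> 'rV[R]_d) (H : R),
    compact Om -> mu Om = 1%E ->
    2 <= p ->
    (forall j, ccont_on Om (phi j)) ->
    (forall j x, Om x -> cabs (phi j x) <= 1) ->
    riesz mu Om phi R1 R2 ->
    (1 <= u)%N -> (u <= N)%N ->
    (forall j, Om (xi j)) ->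
    L2_usd mu Om phi u xi ->
    NI mu Om phi 2 p H u ->
    forall v : nat, (v * (1 + c) <= u)%N ->
    forall f0 : 'rV[R]_d -> R[i], ccont_on Om f0 ->
    forall sel : nat -> 'I_N, womp_run t xi phi f0 sel ->
    forall cf : 'I_N -> R[i], is_proj_coef xi phi (selected sel (c * v)) f0 cf ->
      normm xi (resid phi f0 cf) <= C0 * sigma_m xi v phi f0 /\
      normLp mu Om p (resid phi f0 cf) <= H * C1 * sigma_xi mu xi Om p v phi f0.
Proof.
(* 3 exceeds the square root of the 8 in [energy_le_error]; 312 = 6 * 52, with 6 from [normLpD_le]
   and 52 from [g_Lp]. *)
exists 3, 312; do 2![split; first by rewrite ltr0n].
move=> t R1 R2 t0 _ R1_gt0 R12.
set alpha := R1 ^+ 2 / 2; set beta := 3 / 2 * R2 ^+ 2.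
have alpha0 : 0 < alpha by rewrite divr_gt0 ?exprn_gt0.
have beta0 : 0 <= beta by rewrite mulr_ge0 ?sqr_ge0 ?divr_ge0.
have ta0 : 0 < t ^+ 2 * alpha ^+ 2 by rewrite mulr_gt0 ?exprn_gt0.
pose c := (Num.bound (192 * beta / (t ^+ 2 * alpha ^+ 2))).+1.
have c_large : 192 * beta <= c%:R * t ^+ 2 * alpha ^+ 2.
  rewrite -mulrA -ler_pdivrMr // (le_trans (ltW (archi_boundP _))) ?ler_nat //.
  by apply: divr_ge0 (ltW ta0); apply: mulr_ge0 beta0; exact: ler0n.
exists c; split=> // d N mu Om p phi u m xi H cOm muOm p2 cphi phi1 rsz u0 uN Omxi usd ni.
move=> v vu f0 cf0 sel run cf cfP.
have H4 := NI_const_ge R1_gt0 R12 uN rsz cOm muOm p2 u0 cphi ni.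
have p0 : 0 < p by exact: lt_le_trans p2.
have nphi1 j : normm_sqr xi (phi j) <= 1 by apply: normm_sqr_le1 => i; exact: phi1.
have main a : @vterm R N v a ->
    normm_sqr xi (resid phi f0 cf) <= 8 * normm_sqr xi (resid phi f0 a).
  move=> [T [Tv aT]].
  (* The run provides only indices, so a projection is chosen at every step; [cf] may differ from
     the chosen one, but its residual is no larger. *)
  have [G GP] := choice (fun k => is_proj_coef_exists xi phi (selected sel k) f0).
  apply: le_trans (proj_resid_min cfP (proj1 (GP _))) _.
  have uT : (#|T| + (0 + c * v) <= u)%N by rewrite Tv add0n mulnC -mulnS -add1n.
  have Tn : (#|T :\: selected sel 0| <= v)%N.
    by rewrite -Tv subset_leq_card // finset.subsetDl.
  exact: (energy_le_error (ltW t0) alpha0 beta0 nphi1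
    (sparse_frame_lower R1_gt0 R12 uN rsz usd) (sparse_frame_upper R1_gt0 R12 uN rsz usd)
    run GP c_large aT uT Tn).
(* A set of [v] indices makes the zero combination v-term, so the infima below are over nonempty
   sets. *)
have [J [_ Jv]] : exists J : {set 'I_N}, finset.set0 \subset J /\ #|J| = v.
  apply: subset_of_card; rewrite ?cards0 // card_ord (leq_trans _ uN) // (leq_trans _ vu) //.
  by rewrite leq_pmulr.
have v0 : @vterm R N v (fun=> 0) by exists J.
split.
  rewrite mulrC -ler_pdivrMr // /sigma_m; apply: lb_le_inf;
  first by eexists; exists (fun=> 0).
  move=> _ [a av <-]; rewrite ler_pdivrMr // !normmE.
  rewrite (le_trans (ler_wsqrtr (main a av))) // sqrtrM // mulrC ler_wpM2l ?sqrtr_ge0 //.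
  by rewrite -[leRHS](@ger0_norm _ 3) // -sqrtr_sqr ler_wsqrtr // expr2; lra.
have H0 : 0 < H by lra.
have K1 : 1 <= 52 * H by lra.
have [C CE] : exists C, C = H * 312 by exists (H * 312).
have C_gt0 : 0 < C by rewrite CE; lra.
rewrite -CE mulrC -ler_pdivrMr // /sigma_xi; apply: lb_le_inf;
  first by eexists; exists (fun=> 0).
move=> _ [a av <-]; rewrite ler_pdivrMr //.
set h := resid phi f0 a; set s := normLp _ _ _ h.
have s0 : 0 <= s by exact: powR_ge0.
(* The norm [s] may be 0, while the threshold inequalities need a positive [e]; hence [e > s],
   followed by a limit. *)
suff lim e : s < e -> normLp mu Om p (resid phi f0 cf) <= e * C.
  rewrite -ler_pdivrMr //; apply/ler_addgt0Pr => e e0.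
  by rewrite ler_pdivrMr // lim // ltrDl.
move=> se; have e0 : 0 < e by exact: le_lt_trans se.
have ch : ccont_on Om h by exact: ccont_on_resid.
have se_p : s `^ p <= e `^ p by rewrite ge0_ler_powR ?nnegrE ?(ltW p0) ?(ltW e0) ?(ltW se).
rewrite /s powR_normLp // powint_mu_xi // in se_p.
have := powint_ge0 Om mu p h; have := powmean_ge0 xi p h => pm0 pi0.
have h_mu : powint Om mu p h <= 2 * e `^ p by lra.
have h_xi : normm_sqr xi h <= 3 * e ^+ 2 by apply: (normm_sqr_le_powmean e0 p2); lra.
have := main a av; rewrite -/h => f_xi.
pose b j := a j - cf j; pose g := lincomb phi b.
have cg : ccont_on Om g by exact: ccont_on_lincomb.
have -> : resid phi f0 cf = (fun x => h x + g x).
  by apply/funext => x; rewrite /h /g /resid lincombB; ring.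
(* [g] is the residual minus [h], so its squared norm is at most 2 * (8 * 3 e^2) + 2 * 3 e^2 = 54
   e^2. *)
have g_xi : normm_sqr xi g <= 54 * e ^+ 2.
  have -> : normm_sqr xi g = normm_sqr xi (fun x => resid phi f0 cf x + (-1) * h x).
    by apply: eq_normm_sqr => x; rewrite /h /g /resid lincombB; ring.
  apply: le_trans (normm_sqrD_le _ _ _) _.
  have -> : normm_sqr xi (fun x => (-1) * h x) = normm_sqr xi h.
    by congr (_ * _); apply: eq_bigr => j _; rewrite cabsM cabsN cabs1 mul1r.
  lra.
have b_vterm : @vterm R N u b.
  have [T [Tv aT]] := av; apply: (@vterm_supported _ _ _ uN _ (T :|: selected sel (c * v))).
    rewrite (leq_trans (leq_card_setU _ _)) // Tv (leq_trans _ vu) // mulnDr muln1 leq_add2l.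
    by rewrite mulnC; exact: card_selected.
  apply: supported_onB; first exact: supported_on_sub (finset.subsetUl _ _) aT.
  exact: supported_on_sub (finset.subsetUr _ _) (proj1 cfP).
(* The lower discretization bound gives at most 2 * 54 e^2 = 108 e^2, below (13 e)^2. *)
have g_L2 : normLp mu Om 2 g <= 13 * e.
  have [lo _] := usd b b_vterm; rewrite -/(normm_sqr xi _) -/g in lo.
  rewrite -(@ler_pXn2r _ 2) ?nnegrE ?powR_ge0 ?mulr_ge0 ?(ltW e0) // exprMn.
  have := sqr_ge0 e; lra.
have g_Lp : normLp mu Om p g <= 52 * H * e.
  apply: le_trans (ni b b_vterm) _; rewrite -/g.
  have := ler_wpM2l (ltW H0) g_L2; have := mulr_gt0 H0 e0; lra.
have -> : e * C = 6 * (52 * H) * e by rewrite CE; ring.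
exact: (normLpD_le cOm e0 p2 K1 ch cg h_mu g_Lp).
Qed.
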